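(* Let $M_n$ be a random symmetric Bernoulli matrix and let $M_{n-1}$ be the symmetric matrix obtained from $M_n$ by deleting its first row and first column. Then for every constant $C>0$, $$\mathbb{P}\big(\det(M_n)=0,\ \operatorname{rank}(M_{n-1})=n-2\big)=O(n^{-C}),$$ where the implied constant depends only on $C$.
   Context: A Bernoulli random variable takes values $\pm1$ with probability $1/2$ each. $M_n$ denotes a random symmetric $n\times n$ matrix whose entries $M_n(ij)$, $1\le i\le j\le n$, are independent Bernoulli random variables, with $M_n(ji)=M_n(ij)$. *)

(* Defs.v *)
(* MathComp-Analysis *)
From HB Require Import structures.
From mathcomp Require Import all_boot all_order all_algebra.
From mathcomp Require Import all_classical all_reals all_analysis.

Set Implicit Arguments.
Unset Strict Implicit.
Unset Printing Implicit Defensive.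

Import Order.TTheory GRing.Theory Num.Theory.
Import numFieldNormedType.Exports.

Local Open Scope classical_set_scope.
Local Open Scope ring_scope.

(* Values are +1 and -1, unlike the 0/1-valued [bernoulli_prob] of the
   library. *)
Definition pm1_bernoulli d (T : measurableType d) (R : realType)
    (P : probability T R) (X : {RV P >-> R}) : Prop :=
  P (X @^-1` [set 1]) = (2^-1)%:E /\ P (X @^-1` [set -1]) = (2^-1)%:E.

Definition mutually_independent d (T : measurableType d) (R : realType)
    (P : probability T R) (I : finType) (D : {set I})
    (X : I -> {RV P >-> R}) : Prop :=
  forall (J : {set I}) (A : I -> set R), J \subset D ->
    (forall i, measurable (A i)) ->
    P [set w | forall i, i \in J -> A i (X i w)] =
    (\prod_(i in J) P (X i @^-1` A i))%E.

Definition random_symmetric_bernoulli d (T : measurableType d) (R : realType)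
    (P : probability T R) (n : nat) (M : 'I_n -> 'I_n -> {RV P >-> R}) : Prop :=
  [/\ forall i j w, M j i w = M i j w,
      forall i j : 'I_n, (i <= j)%N -> pm1_bernoulli (M i j) &
      mutually_independent [set p : 'I_n * 'I_n | (p.1 <= p.2)%N]%SET
        (fun p => M p.1 p.2)].

Definition mx_sample d (T : measurableType d) (R : realType)
    (P : probability T R) (n : nat) (M : 'I_n -> 'I_n -> {RV P >-> R})
    (w : T) : 'M[R]_n :=
  \matrix_(i, j) M i j w.

Definition del_first (R : realType) (n : nat) (n_gt0 : (0 < n)%N)
    (A : 'M[R]_n) : 'M[R]_n.-1 :=
  row' (Ordinal n_gt0) (col' (Ordinal n_gt0) A).

(* Main.v *)
(* Let v be a kernel vector of the corank-one block M_(n-1), reduced modulo a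
   prime p of polynomial size; singularity of M_n forces the first row x of M_n
   to be orthogonal to v.  If P(x . v = 0) < n^-c nothing is left to prove, so
   one has to show that, up to an exponentially small probability, no nonzero
   kernel vector v satisfies P(x . v = 0) >= n^-c.

   For a set S of coordinates put f_S(y) = prod_(i in S) |cos(2 pi v_i y / p)|
   and I(S) = (1/p) sum_y f_S(y), which bounds the concentration of the random
   sum of the v_i over S.  Adding greedily to S any coordinate which
   decreases I(S) by a factor 1 - 2^-17, one stops after O(log n) steps, because
   I(S) >= n^-c all along.  Then each remaining v_i lies in a set B of values z
   for which f_S(y) |cos(2 pi z y / p)| has almost the same mean as f_S(y), and B
   depends only on the restriction of v to S.  Up to the dilation by 2, B is
   contained in a level set B_t = {z : sum_y f_S(y) (1 - cos(2 pi z y / p)) <=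
   t sum_y f_S(y)}; since B_t + B_t is contained in B_(4t), and small sets which
   hardly grow under addition are subgroups, |B_t| gains a factor 3/2 each time
   that t is multiplied by 4, until Parseval's identity bounds it by 4 / I(S).
   Hence |B| I(S) <= 1/4, unless B = {0}.  As the rows of M_(n-1) outside S are
   hit independently through their columns in S, a given v is in the kernel with
   probability at most I(S)^(n-1-|S|), and the union bound over v costs only
   (np)^O(|S|) |B|^(n-1-|S|).  If B = {0}, then v is sparse and the trivial bound
   2^-(n-2) suffices. *)
Require Import Defs.
From HB Require Import structures.
From mathcomp Require Import all_boot all_order all_algebra.
From mathcomp Require Import all_classical all_reals all_analysis.
From mathcomp Require Import ring lra zify.

Set Implicit Arguments.
Unset Strict Implicit.
Unset Printing Implicit Defensive.

Import Order.TTheory GRing.Theory Num.Theory.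
Import numFieldNormedType.Exports.

Local Open Scope classical_set_scope.
Local Open Scope ring_scope.

(** * Primes in a polynomial range *)

Lemma expn2_ge_sqr n : (7 <= n -> 2 * n ^ 2 < 2 ^ n)%N.
Proof.
elim: n => // n IH; rewrite leq_eqVlt => /orP[/eqP <- //|n7].
have := IH n7; rewrite (expnS 2 n) -!mulnn => IHn.
have : (7 * n <= n * n)%N by rewrite leq_mul2r; lia.
lia.
Qed.

Lemma expn2_le_central_bin n : (2 ^ n <= 'C(n + n, n))%N.
Proof.
rewrite -binomial.Vandermonde -[X in (X ^ n)%N]/(1 + 1)%N expnDn; apply: leq_sum => i _.
by rewrite !exp1n leq_mul // bin_gt0; lia.
Qed.

(* Legendre's formula: the [k]-th summand of the valuation of [n + n choose n]
   at [q] is at most 1, and vanishes as soon as [q ^ k > n + n]. *)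
Lemma expn_logn_central_bin q n : (prime q -> 0 < n ->
  q ^ logn q 'C(n + n, n) <= n + n)%N.
Proof.
move=> q_pr n_gt0; have q_gt1 := prime_gt1 q_pr.
have n2_gt0 : (0 < n + n)%N by lia.
suff : (logn q 'C(n + n, n) <= trunc_log q (n + n))%N.
  by move=> le_q; apply: leq_trans (trunc_logP q_gt1 n2_gt0); rewrite leq_exp2l.
have factE : (logn q n`! = \sum_(1 <= k < (n + n).+1) n %/ q ^ k)%N.
  rewrite logn_fact // [RHS](big_cat_nat (n := n.+1)) //=; last by lia.
  rewrite [X in _ = (_ + X)%N]big_nat [X in _ = (_ + X)%N]big1 ?addn0 // => k /andP[nk _].
  by apply: divn_small; apply: leq_trans (ltn_expl k q_gt1); lia.
have /(congr1 (logn q)) := bin_fact (leq_addr n n).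
rewrite addnK !lognM ?muln_gt0 ?fact_gt0 ?bin_gt0 ?leq_addr //.
rewrite factE logn_fact // -big_split /=.
set t := trunc_log _ _.
have t_le : (t <= n + n)%N by apply: leq_trans (ltnW (ltn_expl t q_gt1)) (trunc_logP q_gt1 n2_gt0).
rewrite [X in _ = X -> _](big_cat_nat (n := t.+1)) //=.
rewrite [X in _ = (_ + X)%N -> _]big_nat.
rewrite [X in _ = (_ + X)%N -> _]big1 ?addn0; last first.
  move=> k /andP[tk _]; apply: divn_small.
  by apply: leq_trans (trunc_log_ltn _ q_gt1) _; rewrite leq_exp2l.
rewrite [X in (_ + X)%N = _ -> _](big_cat_nat (n := t.+1)) //= => E.
have : (\sum_(1 <= k < t.+1) (n + n) %/ q ^ k <=
        \sum_(1 <= k < t.+1) (1 + (n %/ q ^ k + n %/ q ^ k)))%N.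
  apply: leq_sum => k _; have := expn_gt0 q k; rewrite (ltnW q_gt1) /= => qk.
  have := divn_eq n (q ^ k); have := ltn_pmod n qk.
  have := divn_eq (n + n) (q ^ k); have := ltn_pmod (n + n) qk.
  nia.
rewrite big_split /= sum_nat_const_nat; lia.
Qed.

(** Erdős's argument: with no prime in the range, at most [N] primes divide the central binomial
    coefficient at [M = N ^ 2], each to a power at most [2 * N ^ 2], so that it would not exceed
    [(2 * N ^ 2) ^ N], which is below [2 ^ M]. *)
Lemma exists_prime_between N : (7 <= N)%N ->
  exists p, [/\ prime p, (N < p)%N & (p <= 2 * N ^ 2)%N].
Proof.
move=> N7.
case: (boolP [exists p : 'I_(2 * N ^ 2).+1, prime p && (N < p)%N]).
  by case/existsP => p /andP[p_pr Np]; exists p; split => //; rewrite -ltnS.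
move=> /existsPn noprime.
pose M := (N ^ 2)%N; pose b := 'C(M + M, M).
have M_gt0 : (0 < M)%N by rewrite expn_gt0; lia.
have b_gt0 : (0 < b)%N by rewrite bin_gt0 leq_addr.
have MM : (M + M = 2 * N ^ 2)%N by rewrite mul2n addnn.
have primes_le q : q \in primes b -> (q <= N)%N.
  rewrite mem_primes => /and3P[q_pr _ qb].
  have q_le : (q <= M + M)%N.
    apply: leq_trans (expn_logn_central_bin q_pr M_gt0).
    rewrite -{1}(expn1 q) leq_exp2l ?prime_gt1 // logn_gt0 mem_primes q_pr b_gt0.
    exact: qb.
  rewrite MM -ltnS in q_le.
  by have := noprime (Ordinal q_le); rewrite q_pr /= -leqNgt.
have size_le : (size (primes b) <= N)%N.
  rewrite -[leqRHS](size_iota 1) uniq_leq_size ?primes_uniq // => q qb.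
  rewrite mem_iota add1n ltnS (primes_le _ qb) andbT.
  by move: qb; rewrite mem_primes => /andP[/prime_gt0 ->].
have : (b <= (M + M) ^ N)%N.
  rewrite [leqLHS](prod_prime_decomp b_gt0) prime_decompE big_map /=.
  apply: (@leq_trans ((M + M) ^ size (primes b)))%N; last first.
    by rewrite leq_pexp2l //; lia.
  elim: (primes b) => [|q s IH]; first by rewrite big_nil.
  rewrite big_cons /= expnS leq_mul //.
  have [q_pr|/negPf q_npr] := boolP (prime q); first exact: expn_logn_central_bin.
  by rewrite lognE q_npr expn0; lia.
move=> b_le; exfalso; move: b_le; apply/negP; rewrite -ltnNge.
apply: (leq_trans _ (expn2_le_central_bin M)); rewrite MM.
rewrite /M -mulnn expnM ltn_exp2r ?expn2_ge_sqr //; lia.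
Qed.

(** * Averages over finite functions *)

Section Mean.
Variables (R : realFieldType) (I T : finType).
Hypothesis T_gt0 : (0 < #|T|)%N.
Implicit Types (g h : {ffun I -> T} -> R) (s t : {ffun I -> T}) (D : {set I}).

Definition mean g : R := (\sum_w g w) / #|{ffun I -> T}|%:R.

Definition mix D s t : {ffun I -> T} := [ffun i => if i \in D then t i else s i].

Let cardT_neq0 : #|{ffun I -> T}|%:R != 0 :> R.
Proof. by rewrite pnatr_eq0 card_ffun expn_eq0 negb_and -lt0n T_gt0. Qed.

Let cardT : #|xpredT : pred {ffun I -> T}| = #|{ffun I -> T}|.
Proof. by apply: eq_card. Qed.

Lemma eq_mean g h : g =1 h -> mean g = mean h.
Proof. by move=> gh; congr (_ / _); apply: eq_bigr. Qed.

Lemma ler_mean g h : (forall w, g w <= h w) -> mean g <= mean h.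
Proof. by move=> gh; rewrite ler_wpM2r ?invr_ge0// ler_sum. Qed.

Lemma mean_cst (a : R) : mean (fun=> a) = a.
Proof.
by rewrite /mean sumr_const -[X in X / _]mulr_natr cardT mulfK.
Qed.

Lemma meanD g h : mean (fun w => g w + h w) = mean g + mean h.
Proof. by rewrite /mean big_split mulrDl. Qed.

Lemma meanZ (a : R) g : mean (fun w => a * g w) = a * mean g.
Proof. by rewrite /mean -mulr_sumr mulrA. Qed.

Lemma mean_sum (J : finType) (A : pred J) (g : J -> {ffun I -> T} -> R) :
  mean (fun w => \sum_(j | A j) g j w) = \sum_(j | A j) mean (g j).
Proof. by rewrite /mean exchange_big mulr_suml. Qed.

(* Plays the role of conditioning on the coordinates outside [D]. *)
Lemma mean_mix D g : mean g = mean (fun s => mean (fun t => g (mix D s t))).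
Proof.
rewrite /mean -mulr_suml pair_bigA/=.
(* Swapping the coordinates in [D] between [s] and [t] is an involution of the pairs; it turns
   [mix D s t] back into [s]. *)
rewrite (reindex (fun st : {ffun I -> T} * {ffun I -> T} =>
  (mix D st.1 st.2, mix D st.2 st.1))) /=; last first.
  apply: onW_bij; apply: inv_bij => -[s t] /=.
  by congr (_, _); apply/ffunP => i; rewrite !ffunE; case: (i \in D).
rewrite (eq_bigr (fun st => g st.1)); last first.
  move=> [s t] _ /=; congr g; apply/ffunP => i; rewrite !ffunE.
  by case: (i \in D).
rewrite -(pair_bigA _ (fun s (t : {ffun I -> T}) => g s)) /=.
rewrite [in RHS](eq_bigr (fun s => g s * #|{ffun I -> T}|%:R)) => [|s _]; last first.
  by rewrite sumr_const cardT mulr_natr.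
by rewrite -[in RHS]mulr_suml mulfK.
Qed.

Lemma mean_prod (f : I -> T -> R) :
  mean (fun w => \prod_i f i (w i)) = \prod_i ((\sum_a f i a) / #|T|%:R).
Proof.
rewrite /mean card_ffun natrX -bigA_distr_bigA /=.
by rewrite big_split /= prodr_const exprVn.
Qed.

Lemma mean_coord i (f : T -> R) :
  mean (fun w => f (w i)) = (\sum_a f a) / #|T|%:R.
Proof.
pose f' j a := if j == i then f a else 1.
transitivity (mean (fun w => \prod_j f' j (w j))).
  apply: eq_mean => w; rewrite (bigD1 i) //= /f' eqxx big1 ?mulr1 // => j.
  by move/negPf->.
rewrite mean_prod (bigD1 i) //= [X in _ * X]big1 ?mulr1 => [|j /negPf ji].
  by rewrite /f' eqxx.
by rewrite /f' ji sumr_const divff // pnatr_eq0 -lt0n.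
Qed.

End Mean.

(** * Trigonometric characters of the prime field *)

Section Character.
Variables (R : realType) (p : nat).
Hypothesis p_pr : prime p.
Hypothesis p_gt2 : (2 < p)%N.

(** Real and imaginary parts of the additive character [exp (2 pi i x / p)]. *)
Definition ecos (x : 'F_p) : R := cos (2 * pi * (x : nat)%:R / p%:R).
Definition esin (x : 'F_p) : R := sin (2 * pi * (x : nat)%:R / p%:R).

Let p_neq0 : p%:R != 0 :> R.
Proof. by rewrite pnatr_eq0 -lt0n prime_gt0. Qed.

Let angle_mod n : exists q : nat,
  2 * pi * n%:R / p%:R = 2 * pi * (n%:R : 'F_p)%:R / p%:R + (pi *+ 2) *+ q :> R.
Proof.
exists (n %/ p)%N; rewrite val_Fp_nat // {1}(divn_eq n p) natrD natrM.
by rewrite -(mulr_natr (pi *+ 2)) -(mulr_natr pi); field.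
Qed.

Lemma ecos_nat n : ecos n%:R = cos (2 * pi * n%:R / p%:R).
Proof.
have [q ->] := angle_mod n; rewrite /ecos.
by elim: q => [|q IH]; rewrite ?mulr0n ?addr0 // [X in _ + X]mulrSr addrA cosD2pi.
Qed.

Lemma esin_nat n : esin n%:R = sin (2 * pi * n%:R / p%:R).
Proof.
have [q ->] := angle_mod n; rewrite /esin.
by elim: q => [|q IH]; rewrite ?mulr0n ?addr0 // [X in _ + X]mulrSr addrA sinD2pi.
Qed.

Let addFpE (x y : 'F_p) : x + y = ((x : nat) + (y : nat))%:R.
Proof. by rewrite natrD !natr_Zp. Qed.

Let angleD (a b : nat) :
  2 * pi * (a + b)%:R / p%:R = 2 * pi * a%:R / p%:R + 2 * pi * b%:R / p%:R :> R.
Proof. by rewrite natrD; field. Qed.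

Lemma ecosD x y : ecos (x + y) = ecos x * ecos y - esin x * esin y.
Proof. by rewrite addFpE ecos_nat angleD cosD. Qed.

Lemma esinD x y : esin (x + y) = esin x * ecos y + ecos x * esin y.
Proof. by rewrite addFpE esin_nat angleD sinD. Qed.

Lemma ecos0 : ecos 0 = 1.
Proof. by rewrite /ecos mulr0 mul0r cos0. Qed.

Lemma ecos2Dsin2 x : ecos x ^+ 2 + esin x ^+ 2 = 1.
Proof. exact: cos2Dsin2. Qed.

(** The addition formulas at [x + (- x) = 0] are a linear system in the two unknown values, with
    determinant [ecos x ^+ 2 + esin x ^+ 2 = 1]. *)
Lemma ecosN_esinN x : ecos (- x) = ecos x /\ esin (- x) = - esin x.
Proof.
have := ecosD x (- x); have := esinD x (- x); rewrite subrr ecos0.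
have -> : esin 0 = 0 by rewrite /esin mulr0 mul0r sin0.
have := ecos2Dsin2 x.
move: (ecos x) (esin x) (ecos (- x)) (esin (- x)) => a b c d E1 E2 E3.
split.
  transitivity ((a ^+ 2 + b ^+ 2) * c); first by rewrite E1 mul1r.
  by transitivity (a * (a * c - b * d) + b * (b * c + a * d)); [|rewrite -E2 -E3]; ring.
transitivity ((a ^+ 2 + b ^+ 2) * d); first by rewrite E1 mul1r.
by transitivity (a * (b * c + a * d) - b * (a * c - b * d)); [|rewrite -E2 -E3]; ring.
Qed.

Lemma ecos_le1 x : ecos x <= 1.
Proof. exact: cos_le1. Qed.

Lemma normr_ecos_le1 x : `|ecos x| <= 1.
Proof. by rewrite ler_norml cos_geN1 cos_le1. Qed.

Lemma ecos_double x : ecos (x + x) = 2 * ecos x ^+ 2 - 1.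
Proof. by rewrite ecosD; have := ecos2Dsin2 x; rewrite !expr2 => ?; lra. Qed.

(** Amounts to [(1 - |ecos x|) ^+ 2 >= 0]; the absolute value is removed at the price of a dilation
    by 2. *)
Lemma normr_ecos_double x : `|ecos x| <= 3 / 4 + ecos (x + x) / 4.
Proof.
rewrite ecos_double -real_normK ?num_real //.
by have := sqr_ge0 (1 - `|ecos x|); rewrite !expr2 => ?; nra.
Qed.

(* [|u w - 1| ^ 2 <= 2 |u - 1| ^ 2 + 2 |w - 1| ^ 2] on the unit circle. *)
Lemma one_sub_ecosD x y :
  1 - ecos (x + y) <= 2 * (1 - ecos x) + 2 * (1 - ecos y).
Proof.
rewrite ecosD; have := ecos2Dsin2 x; have := ecos2Dsin2 y.
move: (ecos x) (esin x) (ecos y) (esin y) => a b c d E1 E2.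
have := sqr_ge0 (a * c - b * d - 2 * a + 1).
have := sqr_ge0 (b * c + a * d - 2 * b).
suff : 2 * (2 * (1 - a) + 2 * (1 - c) - (1 - (a * c - b * d))) =
  (b * c + a * d - 2 * b) ^+ 2 + (a * c - b * d - 2 * a + 1) ^+ 2 by lra.
have -> : (b * c + a * d - 2 * b) ^+ 2 + (a * c - b * d - 2 * a + 1) ^+ 2 =
  (a ^+ 2 + b ^+ 2) * (c ^+ 2 + d ^+ 2) + 4 * (a ^+ 2 + b ^+ 2) + 1
  - 4 * c * (a ^+ 2 + b ^+ 2) + 2 * (a * c - b * d) - 4 * a by ring.
by rewrite E1 E2; ring.
Qed.

(** Translation by 1 rotates the vector of the cosine and sine sums by the angle [2 pi / p]; being
    invariant, that vector is 0. *)
Lemma sum_ecos : \sum_x ecos x = 0.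
Proof.
have sumD (f : 'F_p -> R) : \sum_x f (x + 1) = \sum_x f x.
  by rewrite [RHS](reindex_inj (addIr 1)).
have E1 := sumD ecos; have E2 := sumD esin.
rewrite (eq_bigr _ (fun x _ => ecosD x 1)) in E1.
rewrite (eq_bigr _ (fun x _ => esinD x 1)) in E2.
rewrite sumrB -!mulr_suml in E1; rewrite big_split -!mulr_suml /= in E2.
have c1 : ecos 1 < 1.
  rewrite lt_neqAle ecos_le1 andbT; apply/eqP.
  have -> : (1 : 'F_p) = 1%:R by [].
  rewrite ecos_nat mulr1 => c1.
  have : 2 * pi / p%:R = 0 :> R.
    apply: cos_inj; rewrite ?cos0 // in_itv /= ?lexx ?pi_ge0 //.
    have := pi_gt0 R => pi0; apply/andP; split.
      by rewrite divr_ge0 // mulr_ge0 // pi_ge0.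
    rewrite ler_pdivrMr ?ltr0n ?prime_gt0 // mulrC ler_pM2l //.
    by rewrite ler_nat ltnW.
  apply/eqP; rewrite !mulf_eq0 invr_eq0 (negPf p_neq0) (gt_eqF (pi_gt0 R)).
  by rewrite pnatr_eq0.
have := ecos2Dsin2 1; move: c1 E1 E2.
move: (ecos 1) (esin 1) (\sum_x ecos x) (\sum_x esin x) => c s A B c1 E1 E2 E3.
have : (1 - c) * A = 0.
  have -> : (1 - c) * A = ((1 - c) * (A - (A * c - B * s)) - s * (B - (B * c + A * s))
    + (1 - (c ^+ 2 + s ^+ 2)) * A) / 2 by field.
  by rewrite E1 E2 E3; ring.
by move/eqP; rewrite mulf_eq0 subr_eq0 [1 == c]gt_eqF //= => /eqP.
Qed.

Lemma sum_ecosM z : \sum_x ecos (z * x) = if z == 0 then p%:R else 0.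
Proof.
case: eqVneq => [-> | z0].
  under eq_bigr do rewrite mul0r ecos0.
  by rewrite sumr_const card_Fp.
by rewrite -[RHS]sum_ecos [RHS](reindex_inj (mulfI z0)).
Qed.

End Character.

(** * Level sets of the spectrum *)

(* If [2 * #|B| < 3 * #|A|], every difference of two elements of [A] has more
   than [#|A| / 2] representations, so that [A - A] is a subgroup of ['F_p]. *)
Lemma card_sumset_Fp (p : nat) (A B : {set 'F_p}) : prime p ->
  (forall x, x \in A -> - x \in A) ->
  (forall x y, x \in A -> y \in A -> x + y \in B) ->
  (1 < #|A|)%N -> (#|B| < p)%N -> (3 * #|A| <= 2 * #|B|)%N.
Proof.
move=> p_pr AN AB A1 Bp; rewrite leqNgt; apply/negP => ltBA.
pose H (x : 'F_p) := exists a b, [/\ a \in A, b \in A & x = a - b].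
pose rep (x : 'F_p) := [set w in A | w - x \in A]%SET.
have rep_gt x : H x -> (#|A| < 2 * #|rep x|)%N.
  case=> a [b [aA bA ->]].
  pose Aa := [set a + u | u in A]%SET; pose Ab := [set b + u | u in A]%SET.
  have cAa : #|Aa| = #|A| by rewrite card_imset //; apply: addrI.
  have cAb : #|Ab| = #|A| by rewrite card_imset //; apply: addrI.
  have cI : (#|Aa :&: Ab|%SET <= #|rep (a - b)%R|)%N.
    rewrite -(card_imset (mem (rep (a - b))) (@addrI _ b)).
    apply/subset_leq_card/fintype.subsetP => z /setIP[/imsetP[u uA ->] /imsetP[w wA]].
    move=> E; apply/imsetP; exists w => //; rewrite inE wA /=.
    suff -> : w - (a - b) = u by [].
    by rewrite opprB addrA [w + b]addrC -E addrC addKr.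
  have cU : (#|Aa :|: Ab|%SET <= #|B|)%N.
    apply/subset_leq_card/fintype.subsetP => z /setUP[] /imsetP[u uA ->]; exact: AB.
  have := cardsUI Aa Ab; lia.
have HS x y : H x -> H y -> H (y - x).
  move=> /rep_gt hx /rep_gt hy.
  have : (0 < #|rep x :&: rep y|%SET)%N.
    have : (#|rep x :|: rep y|%SET <= #|A|)%N.
      apply/subset_leq_card/fintype.subsetP => z /setUP[]; by rewrite inE => /andP[].
    have := cardsUI (rep x) (rep y); lia.
  case/card_gt0P => w /setIP[]; rewrite !inE => /andP[_ wx] /andP[_ wy].
  by exists (w - x), (w - y); split => //; ring.
have [a [b [aA bA ab]]] : exists a b, [/\ a \in A, b \in A & a != b].
  by case/card_gt1P: A1 => a [b [aA bA ab]]; exists a, b.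
have H0 : H 0 by exists a, a; rewrite subrr.
have HD x y : H x -> H y -> H (x + y).
  by move=> hx hy; rewrite (_ : x + y = y - (0 - x)); [exact: HS (HS _ _ hx H0) hy|ring].
have Hd : H (a - b) by exists a, b.
have Hk (k : nat) : H ((a - b) *+ k).
  by elim: k => [|k IH]; rewrite ?mulr0n // mulrS; apply: HD.
have HT z : H z.
  have ab0 : a - b != 0 by rewrite subr_eq0.
  rewrite -[z](mulfVK ab0) -[z / _]natr_Zp mulr_natl; exact: Hk.
suff : (p <= #|B|)%N by rewrite leqNgt Bp.
rewrite -[X in (X <= _)%N](card_Fp p_pr) -cardsT.
apply/subset_leq_card/fintype.subsetP => z _.
by have [u [w [uA wA ->]]] := HT z; apply: AB => //; apply: AN.
Qed.

Section Spectrum.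
Variables (R : realType) (p : nat).
Hypothesis p_pr : prime p.
Hypothesis p_gt2 : (2 < p)%N.
Local Notation ecos := (@ecos R p).

Variable f : 'F_p -> R.
Hypothesis f_ge0 : forall x, 0 <= f x.
Hypothesis f_le1 : forall x, f x <= 1.

Definition spectrum (t : R) : {set 'F_p} :=
  [set z | \sum_x f x * (1 - ecos (z * x)) <= t * \sum_x f x]%SET.

(** The exponent is 17 = 15 + 2: the dilation by 2 turns [2^-17] into the level [2^-15], and seven
    multiplications by 4 lead from there to [1 / 2]. *)
Definition heavy : {set 'F_p} :=
  [set z | (1 - (2 ^+ 17)^-1) * (\sum_x f x) <=
           \sum_x f x * `|ecos (z * x)|]%SET.

Lemma spectrumN t z : z \in spectrum t -> - z \in spectrum t.
Proof.
rewrite !inE; congr (_ <= _); apply: eq_bigr => x _.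
by rewrite mulNr (ecosN_esinN R p_pr _).1.
Qed.

Lemma spectrumD t y z : y \in spectrum t -> z \in spectrum t ->
  y + z \in spectrum (4 * t).
Proof.
rewrite !inE => hy hz.
suff : \sum_x f x * (1 - ecos ((y + z) * x)) <=
    \sum_x 2 * (f x * (1 - ecos (y * x))) + \sum_x 2 * (f x * (1 - ecos (z * x))).
  by rewrite -!mulr_sumr; lra.
rewrite -big_split; apply: ler_sum => x _ /=; rewrite mulrDl.
have := one_sub_ecosD R p_pr (y * x) (z * x); have := f_ge0 x; nra.
Qed.

Lemma sum_ecosMM x y : \sum_z ecos (z * x) * ecos (z * y) =
  p%:R / 2 * ((x == - y)%:R + (x == y)%:R).
Proof.
have -> : \sum_z ecos (z * x) * ecos (z * y) =
    (\sum_z ecos ((x + y) * z) + \sum_z ecos ((x - y) * z)) / 2.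
  rewrite -big_split mulr_suml; apply: eq_bigr => z _ /=.
  have [cN sN] := ecosN_esinN R p_pr (y * z).
  rewrite !mulrDl mulNr !(ecosD _ p_pr) cN sN (mulrC x) (mulrC y); lra.
by rewrite !sum_ecosM // subr_eq0 addr_eq0; do 2 case: eqP => _ /=; lra.
Qed.

(** Parseval: the cosine transform [g] of [f] is at least half of [\sum_x f x] on the level set,
    whereas [\sum_z g z ^+ 2] is at most [p] times that sum because [f] is at most 1. *)
Lemma card_spectrum t : t <= 2^-1 ->
  #|spectrum t|%:R * (\sum_x f x) <= 4 * p%:R.
Proof.
move=> t_le; set W := \sum_x f x.
have W_ge0 : 0 <= W by apply: sumr_ge0.
pose g z := \sum_x f x * ecos (z * x).
have g_ge z : z \in spectrum t -> W / 2 <= g z.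
  rewrite inE -/W; have -> : \sum_x f x * (1 - ecos (z * x)) = W - g z.
    by rewrite /W /g -sumrB; apply: eq_bigr => x _; ring.
  by nra.
have : #|spectrum t|%:R * (W / 2) ^+ 2 <= \sum_z g z ^+ 2.
  rewrite mulr_natl -sumr_const big_mkcond; apply: ler_sum => z _.
  case: ifP => [/g_ge gz|_]; last exact: sqr_ge0.
  by rewrite ler_pXn2r ?nnegrE //; lra.
have : \sum_z g z ^+ 2 <= W * p%:R.
  have -> : \sum_z g z ^+ 2 =
      \sum_x f x * \sum_y f y * \sum_z ecos (z * x) * ecos (z * y).
    transitivity (\sum_z \sum_x \sum_y f x * f y * (ecos (z * x) * ecos (z * y))).
      apply: eq_bigr => z _; rewrite expr2 big_distrl; apply: eq_bigr => x _ /=.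
      by rewrite big_distrr; apply: eq_bigr => y _ /=; ring.
    rewrite exchange_big; apply: eq_bigr => x _ /=.
    rewrite exchange_big mulr_sumr; apply: eq_bigr => y _ /=.
    by rewrite !mulr_sumr; apply: eq_bigr => z _; ring.
  rewrite /W mulr_suml; apply: ler_sum => x _; rewrite ler_wpM2l //.
  under eq_bigr do rewrite sum_ecosMM.
  have -> : \sum_y f y * (p%:R / 2 * ((x == - y)%:R + (x == y)%:R)) =
      p%:R / 2 * (\sum_y f y * (y == - x)%:R + \sum_y f y * (y == x)%:R).
    rewrite -big_split mulr_sumr; apply: eq_bigr => y _ /=.
    by rewrite (eq_sym x (- y)) eqr_oppLR (eq_sym x y); ring.
  have pick a : \sum_y f y * (y == a)%:R = f a.
    rewrite (bigD1 a) //= eqxx mulr1 big1 ?addr0 // => y /negPf ->.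
    by rewrite mulr0.
  rewrite !pick; have := f_le1 x; have := f_le1 (- x).
  have : 0 <= p%:R :> R by [].
  nra.
have [->|W0] := eqVneq W 0; first by rewrite !mulr0 mulr_ge0.
have W_gt0 : 0 < W by rewrite lt_neqAle eq_sym W0.
move=> h1 h2; rewrite -(ler_pM2r W_gt0); move: (le_trans h2 h1); rewrite !expr2; lra.
Qed.

Lemma heavy_or_trivial : 4 < \sum_x f x ->
  (forall z, z \in heavy -> z = 0) \/ #|heavy|%:R * (\sum_x f x) <= p%:R / 4.
Proof.
move=> W4; set W := \sum_x f x in W4 *.
(* Seven enlargements are enough, as [(3 / 2) ^ 7 > 16]; they end at [t 7 = 1 / 2],
   the last level to which [card_spectrum] applies. *)
pose t j : R := 4 ^+ j / 2 ^+ 15.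
have tS j : 4 * t j = t j.+1 by rewrite /t [4 ^+ j.+1]exprS mulrA.
have card_le j : (j <= 7)%N -> #|spectrum (t j)|%:R * W <= 4 * p%:R.
  move=> j7; apply: card_spectrum; rewrite /t ler_pdivrMr ?exprn_gt0 //.
  have -> : 2^-1 * 2 ^+ 15 = 4 ^+ 7 :> R by field.
  by rewrite ler_weXn2l // ler1n.
(* Here [4 < W] is used: it keeps the level sets proper, as [card_sumset_Fp] requires. *)
have card_lt j : (j <= 7)%N -> (#|spectrum (t j)| < p)%N.
  move=> j7; have := card_le _ j7; rewrite -(ltr_nat R).
  have : 0 < p%:R :> R by rewrite ltr0n prime_gt0.
  by nra.
(* As [p] is odd, doubling is injective; by [normr_ecos_double] it maps [heavy] into the lowest
   level set. *)
have heavy_le : (#|heavy| <= #|spectrum (t 0)|)%N.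
  have inj : injective (fun z : 'F_p => z + z).
    move=> y z E; apply/eqP; rewrite -subr_eq0.
    have : (y - z) * 2%:R == 0.
      by rewrite mulr_natr mulr2n addrACA E -opprD subrr.
    rewrite mulf_eq0 => /orP[//|].
    by rewrite -(dvdn_pcharf (pchar_Fp p_pr)) => /dvdn_leq; lia.
  rewrite -(card_imset (mem heavy) inj).
  apply/subset_leq_card/fintype.subsetP => _ /imsetP[z zh ->].
  move: zh; rewrite !inE -/W => zh.
  have : \sum_x f x * `|ecos (z * x)| <= \sum_x (f x - f x * (1 - ecos ((z + z) * x)) / 4).
    apply: ler_sum => x _; rewrite mulrDl.
    have := normr_ecos_double R p_pr (z * x); have := f_ge0 x; nra.
  rewrite sumrB -mulr_suml -/W /t expr0.
  have -> : 1 / 2 ^+ 15 = 4 * (2 ^+ 17)^-1 :> R by field.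
  by move: ((2 ^+ 17)^-1 : R) zh => k; lra.
case: (leqP #|spectrum (t 0)| 1) => [le1 | gt1].
  left => z zh; apply/eqP.
  have h0 : 0 \in heavy.
    have W0 : \sum_x f x * `|ecos (0 * x)| = W.
      by apply: eq_bigr => x _; rewrite mul0r ecos0 normr1 mulr1.
    rewrite inE W0 -/W; have : 0 <= (2 ^+ 17)^-1 :> R by rewrite invr_ge0 exprn_ge0.
    by nra.
  have /card_le1_eqP h : (#|heavy| <= 1)%N by apply: leq_trans le1.
  by rewrite (h z 0).
right.
have grow j : (j <= 7)%N -> (3 / 2) ^+ j * #|spectrum (t 0)|%:R <= #|spectrum (t j)|%:R :> R /\
    (1 < #|spectrum (t j)|)%N.
  elim: j => [|j IH] j7; first by rewrite expr0 mul1r.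
  have [h1 h2] := IH (ltnW j7).
  have := card_sumset_Fp p_pr (@spectrumN (t j)) (@spectrumD (t j)) h2.
  rewrite tS => /(_ (card_lt _ j7)) h3; split; last by lia.
  rewrite -(ler_nat R) !natrM in h3; rewrite exprS; lra.
have [h _] := grow _ (leqnn 7); have := card_le _ (leqnn 7).
have : #|heavy|%:R <= #|spectrum (t 0)|%:R :> R by rewrite ler_nat.
have E7 : (3 / 2) ^+ 7 = 2187 / 128 :> R by field.
rewrite E7 in h.
have : 0 <= #|heavy|%:R :> R by [].
move: h; move: (#|heavy|%:R : R) (#|spectrum (t 0)|%:R : R) (#|spectrum (t 7)|%:R : R).
move=> a b c h1 h2 h3; have : 16 * a <= c by lra.
move=> h4 h5; have : 16 * a * W <= c * W by rewrite ler_wpM2r //; lra.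
lra.
Qed.

End Spectrum.

(** * Random signed sums *)

Lemma greedy_set (R : realFieldType) (J : finType) (W : {set J} -> R) (q : R) s :
  0 <= q ->
  exists S : {set J}, (#|S| <= s)%N /\
    ((forall i, i \notin S -> q * W S <= W (i |: S)%SET) \/
     W S <= q ^+ s * W finset.set0).
Proof.
move=> q0; elim: s => [|s [S [Ss [stable|drop]]]].
- by exists finset.set0; rewrite cards0 expr0 mul1r; split => //; right.
- by exists S; split; [exact: leqW | left].
case: (boolP [forall i, (i \notin S) ==> (q * W S <= W (i |: S)%SET)]).
  move/forallP => stable; exists S; split; first exact: leqW.
  by left => i iS; apply: (implyP (stable i)).
rewrite negb_forall => /existsP[i]; rewrite negb_imply -ltNge => /andP[iS lti].
exists (i |: S)%SET; split; first by rewrite cardsU1 iS.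
right; rewrite exprS -mulrA; apply: le_trans (ltW lti) _.
exact: ler_wpM2l.
Qed.

(** Polymorphic in the ring: the same boolean pattern serves as signs in [int], in ['F_p] and in the
    reals. *)
Definition sgnb (A : pzRingType) (b : bool) : A := (-1) ^+ b.

Section Walk.
Variables (R : realType) (p : nat).
Hypothesis p_pr : prime p.
Hypothesis p_gt2 : (2 < p)%N.
Local Notation ecos := (@ecos R p).
Variable J : finType.
Implicit Types (v : J -> 'F_p) (S : {set J}).

Definition cosprod v S (x : 'F_p) : R := \prod_(i in S) `|ecos (v i * x)|.

(** In the notation of the overview, [cosprod] is f_S and this is [p] times I(S). *)
Definition cosmass v S : R := \sum_x cosprod v S x.

Lemma cosprod_ge0 v S x : 0 <= cosprod v S x.
Proof. by apply: prodr_ge0. Qed.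

Lemma cosprod_le1 v S x : cosprod v S x <= 1.
Proof. by apply: prodr_ile1 => i _; rewrite normr_ge0 normr_ecos_le1. Qed.

Lemma cosmass_mono v S S' : S \subset S' -> cosmass v S' <= cosmass v S.
Proof.
move=> SS'; apply: ler_sum => x _; rewrite /cosprod.
rewrite [X in X <= _](big_setID S) /= (finset.setIidPr SS').
rewrite ler_piMr ?cosprod_ge0 //.
by apply: prodr_ile1 => i _; rewrite normr_ge0 normr_ecos_le1.
Qed.

Lemma cosmass0 v : cosmass v finset.set0 = p%:R.
Proof.
rewrite /cosmass /cosprod; under eq_bigr do rewrite big_set0.
by rewrite sumr_const card_Fp.
Qed.

Lemma cosmass_ge0 v S : 0 <= cosmass v S.
Proof. by apply: sumr_ge0 => x _; apply: cosprod_ge0. Qed.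

Lemma eq_cosprod v v' S : {in S, v =1 v'} -> cosprod v S =1 cosprod v' S.
Proof. by move=> vv' x; apply: eq_bigr => i /vv' ->. Qed.

Lemma eq_cosmass v v' S : {in S, v =1 v'} -> cosmass v S = cosmass v' S.
Proof. by move=> vv'; apply: eq_bigr => x _; apply: eq_cosprod. Qed.

Lemma eq_heavy v v' S : {in S, v =1 v'} ->
  heavy (cosprod v S) = heavy (cosprod v' S).
Proof. by move=> vv'; congr heavy; apply/funext; apply: eq_cosprod. Qed.

(** The greedy process must end in its stable case, since a drop of the mass of [S] would by
    monotonicity bound the mass of the full index set. Stability under adjoining [i] says that [v i]
    is heavy. *)
Lemma heavy_structure v s :
  (1 - (2 ^+ 17)^-1) ^+ s * p%:R < cosmass v [set: J]%SET ->
  exists S, (#|S| <= s)%N /\ forall i, i \notin S -> v i \in heavy (cosprod v S).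
Proof.
move=> big.
have q0 : 0 <= 1 - (2 ^+ 17)^-1 :> R.
  by rewrite subr_ge0 invf_le1 ?exprn_gt0 // exprn_ege1 // ler1n.
have [S [Ss [stable|drop]]] := greedy_set (cosmass v) s q0; last first.
  have := cosmass_mono v (finset.subsetT S).
  by rewrite leNgt (le_lt_trans drop) // cosmass0.
exists S; split => // i iS; rewrite inE; apply: le_trans (stable i iS) _.
apply: ler_sum => x _; rewrite /cosprod big_setU1 //= mulrC.
exact: lexx.
Qed.

Variables (I : finType) (e : J -> I).

(** Averaging over one sign uses [cos (a + b) + cos (a - b) = 2 cos a cos b]; the offset [a] is
    arbitrary so that the induction can absorb the exposed sign into it. *)
Lemma mean_ecos_walk (v : J -> 'F_p) (r : seq J) (a y : 'F_p) :
  {in r &, injective e} -> uniq r ->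
  mean (fun t : {ffun I -> bool} =>
    ecos (y * (a + \sum_(j <- r) sgnb _ (t (e j)) * v j))) =
  ecos (y * a) * \prod_(j <- r) ecos (v j * y).
Proof.
elim: r a => [|j r IH] a inj /=.
  move=> _; under eq_mean do rewrite big_nil addr0.
  by rewrite mean_cst ?card_bool // big_nil mulr1.
case/andP=> jr r_uniq; have bool0 : (0 < #|{: bool}|)%N by rewrite card_bool.
rewrite (mean_mix bool0 [set e j]%SET).
pose h (b : bool) (s : {ffun I -> bool}) :=
  ecos (y * (a + sgnb _ b * v j + \sum_(j <- r) sgnb _ (s (e j)) * v j)).
rewrite (eq_mean (h := fun s => (h true s + h false s) / 2)); last first.
  move=> s; rewrite (eq_mean (h := fun t => h (t (e j)) s)).
    by rewrite (mean_coord bool0 (e j) (h^~ s)) big_bool card_bool.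
  move=> t; rewrite /h big_cons addrA; congr (ecos (y * (_ + _ + _))).
    by rewrite ffunE inE eqxx.
  apply: eq_big_seq => k kr; rewrite ffunE inE.
  case: eqP => // ekj; have kj : k = j.
    by apply: inj; rewrite ?inE ?kr ?orbT ?eqxx.
  by move: jr; rewrite -kj kr.
rewrite (eq_mean (h := fun s => 2^-1 * h true s + 2^-1 * h false s)); last first.
  by move=> s; rewrite mulrDl !(mulrC 2^-1).
rewrite meanD !meanZ /h !IH //; try by move=> ? ? h1 h2; apply: inj; rewrite inE ?h1 ?h2 orbT.
rewrite big_cons /sgnb expr0 expr1 !mul1r mulN1r.
have [cN sN] := ecosN_esinN R p_pr (y * v j).
rewrite !mulrDr mulrN !(ecosD _ p_pr) cN sN (mulrC (v j)).
by field.
Qed.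

(** Fourier inversion: the indicator of [z = 0] is the mean over [y] of [ecos (y * z)], and each
    frequency [y] contributes at most [cosprod v S y]. *)
Lemma mean_walk_le (v : J -> 'F_p) S (a : 'F_p) : {in S &, injective e} ->
  mean (fun t : {ffun I -> bool} =>
    (a + \sum_(j in S) sgnb _ (t (e j)) * v j == 0)%:R) <= cosmass v S / p%:R.
Proof.
move=> inj; have p_gt0 : 0 < p%:R :> R by rewrite ltr0n prime_gt0.
rewrite (eq_mean (h := fun t => p%:R^-1 *
  \sum_y ecos (y * (a + \sum_(j <- enum S) sgnb _ (t (e j)) * v j)))); last first.
  move=> t; rewrite big_enum /=; set z := _ + _.
  under eq_bigr do rewrite mulrC.
  rewrite sum_ecosM //; case: eqP => _; first by rewrite mulVf // gt_eqF.
  by rewrite mulr0.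
rewrite meanZ mean_sum mulrC ler_wpM2r ?invr_ge0 ?(ltW p_gt0) //.
apply: ler_sum => y _; rewrite mean_ecos_walk ?enum_uniq //; last first.
  by move=> i j; rewrite !mem_enum; apply: inj.
apply: le_trans (ler_norm _) _; rewrite normrM normr_prod big_enum /=.
by rewrite -[leRHS]mul1r ler_wpM2r ?normr_ecos_le1 // cosprod_ge0.
Qed.

End Walk.

(** * Kernels of random symmetric sign matrices *)

Lemma card_small_sets (J : finType) s :
  (#|[set S : {set J} | (#|S| <= s)%N]%SET| <= #|J|.+1 ^ s)%N.
Proof.
(* A function on ['I_s] lists the elements of a set, with [None] as padding for fewer than [s]
   elements. *)
pose dec (tau : {ffun 'I_s -> option J}) : {set J} :=
  [set x | [exists k, tau k == Some x]]%SET.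
apply: (@leq_trans #|[set dec tau | tau : {ffun 'I_s -> option J}]%SET|).
  apply/subset_leq_card/fintype.subsetP => S; rewrite inE => Ss.
  apply/imsetP; exists [ffun k : 'I_s => nth None (map Some (enum S)) k] => //.
  apply/setP => x; rewrite inE; apply/idP/existsP => [xS|[k /eqP]].
    have lt_x : (index x (enum S) < s)%N.
      by apply: leq_trans Ss; rewrite cardE index_mem mem_enum.
    exists (Ordinal lt_x); rewrite ffunE /= (nth_map x) ?index_mem ?mem_enum //.
    by rewrite nth_index // mem_enum.
  rewrite ffunE; have [lt_k|ge_k] := ltnP k (size (enum S)).
    by rewrite (nth_map x) // => -[<-]; rewrite -mem_enum mem_nth.
  by rewrite nth_default // size_map.
by apply: leq_trans (leq_imset_card _ _) _; rewrite card_ffun card_option card_ord.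
Qed.

(** Once the coordinates in [S] are fixed, [G] and [w] are constant and each other coordinate
    contributes a factor [#|G v| * w v <= c]; there are [#|T| ^ #|S|] ways to fix them. *)
Lemma sum_structured_le (R : realFieldType) (J T : finType) (S : {set J})
    (G : {ffun J -> T} -> {set T}) (w : {ffun J -> T} -> R) (c : R) :
  (forall u v : {ffun J -> T}, {in S, u =1 v} -> G u = G v /\ w u = w v) ->
  (forall v, 0 <= w v) -> (forall v, #|G v|%:R * w v <= c) -> (0 < #|T|)%N ->
  \sum_(v : {ffun J -> T}) [forall i, (i \notin S) ==> (v i \in G v)]%:R * w v ^+ #|~: S|%SET
    <= #|T|%:R ^+ #|S| * c ^+ #|~: S|%SET.
Proof.
move=> Gw w0 Gwc T0; pose g (v : {ffun J -> T}) : R :=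
  [forall i, (i \notin S) ==> (v i \in G v)]%:R * w v ^+ #|~: S|%SET.
rewrite -/(\sum_v g v).
have T_gt0 : 0 < #|T|%:R :> R by rewrite ltr0n.
have -> : \sum_v g v = #|T|%:R ^+ #|J| * mean g.
  by rewrite /mean card_ffun natrX mulrC divfK // expf_neq0 // gt_eqF.
suff h : mean g <= (c / #|T|%:R) ^+ #|~: S|%SET.
  apply: le_trans (ler_wpM2l _ h) _; first by rewrite exprn_ge0.
  rewrite -(cardsC S) exprD expr_div_n -mulrA ler_wpM2l ?exprn_ge0 //.
  by rewrite mulrC divfK // expf_neq0 // gt_eqF.
rewrite (mean_mix T0 (~: S)%SET) -(@mean_cst R J T T0 (_ ^+ _)).
apply: ler_mean => s.
pose f i a : R := if i \in S then 1 else (a \in G s)%:R * w s.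
rewrite (eq_mean (h := fun t => \prod_i f i (t i))); last first.
  move=> t; rewrite /g.
  have [|-> ->] := Gw (mix (~: S)%SET s t) s.
    by move=> i iS; rewrite ffunE inE iS.
  rewrite (bigID (mem S)) /= [X in _ = X * _]big1 ?mul1r; last first.
    by move=> i iS; rewrite /f iS.
  have -> : \prod_(i | i \notin S) f i (t i) =
      \prod_(i | i \notin S) (t i \in G s)%:R * w s ^+ #|~: S|%SET.
    rewrite -prodr_const [X in _ = _ * X](eq_bigl (fun i => i \notin S)).
      by rewrite -big_split; apply: eq_bigr => i /negPf iS; rewrite /f iS.
    by move=> i; rewrite inE.
  congr (_ * _); case: forallP => [h|h].
    rewrite big1 // => i iS; have := implyP (h i) iS.
    by rewrite ffunE inE iS => ->.
  suff [i iS tG] : exists2 i, i \notin S & t i \notin G s.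
    by rewrite (bigD1 i) //= (negPf tG) mul0r.
  apply: contra_notP h => h i; apply/implyP => iS; rewrite ffunE inE iS.
  by apply: contra_notT h => tG; exists i.
rewrite mean_prod // (bigID (mem S)) /= big1 ?mul1r; last first.
  move=> i iS; rewrite /f iS sumr_const.
  by rewrite (eq_card (B := T)) // divff // gt_eqF.
rewrite (eq_bigr (fun=> #|G s|%:R * w s / #|T|%:R)); last first.
  move=> i /negPf iS; rewrite /f iS -mulr_suml; congr (_ * _ / _).
  rewrite -sum1_card natr_sum [RHS]big_mkcond.
  by apply: eq_bigr => a _; case: ifP.
rewrite (eq_bigl (mem (~: S)%SET)); last by move=> i; rewrite !inE.
rewrite prodr_const lerXn2r ?nnegrE ?divr_ge0 ?mulr_ge0 //.
  by apply: le_trans (Gwc s); rewrite mulr_ge0.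
by rewrite ler_pM2r ?invr_gt0.
Qed.

Section SymmetricKernel.
Variables (R : realType) (p : nat).
Hypothesis p_pr : prime p.
Hypothesis p_gt2 : (2 < p)%N.
Variables (m : nat) (I : finType) (e : 'I_m -> 'I_m -> I).
Hypothesis e_inj : forall i j k l, e i j = e k l -> i = k /\ j = l \/ i = l /\ j = k.
Implicit Types (v : {ffun 'I_m -> 'F_p}) (t : {ffun I -> bool}).

Definition row_vanishes v i t := \sum_j sgnb _ (t (e i j)) * v j == 0.

Definition in_kernel v t := [forall i, row_vanishes v i t].

Let bool0 : (0 < #|{: bool}|)%N. Proof. by rewrite card_bool. Qed.

Let e_injr i : injective (e i).
Proof. by move=> j k /e_inj[[]|[<- ->]]. Qed.

(* The rows outside [S] are exposed one at a time: their entries in the columns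
   of [S] are all distinct entries of the symmetric matrix. *)
Lemma mean_rows_le v (S : {set 'I_m}) (rho : R) (r : seq 'I_m) :
  0 <= rho -> uniq r -> {in r, forall i, i \notin S} ->
  (forall a i, mean (fun t : {ffun I -> bool} =>
     (a + \sum_(j in S) sgnb _ (t (e i j)) * v j == 0)%:R) <= rho) ->
  mean (fun t => (all (fun i => row_vanishes v i t) r)%:R) <= rho ^+ size r.
Proof.
move=> rho0 r_uniq rS rhoP; elim: r r_uniq rS => [|i r IH] /=.
  by rewrite mean_cst // expr0.
case/andP=> ir r_uniq rS.
have iS : i \notin S by apply: rS; rewrite mem_head.
have {}IH := IH r_uniq (fun k kr => rS k (mem_behead (s := i :: r) kr)).
have {}rS k : k \in r -> k \notin S by move=> kr; apply: rS; rewrite inE kr orbT.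
rewrite (mean_mix bool0 [set e i j | j in S]%SET) exprS.
apply: le_trans (ler_wpM2l rho0 IH); rewrite -meanZ; apply: ler_mean => s.
pose a := \sum_(j | j \notin S) sgnb _ (s (e i j)) * v j.
rewrite (eq_mean (h := fun t => (all (fun k => row_vanishes v k s) r)%:R *
  (a + \sum_(j in S) sgnb _ (t (e i j)) * v j == 0)%:R)).
  by rewrite meanZ mulrC ler_wpM2r.
move=> t; rewrite -mulnb natrM mulrC; congr (_%:R * _%:R).
  congr (nat_of_bool _); apply: eq_in_all => k kr; congr (_ == _).
  apply: eq_bigr => j _; rewrite ffunE; case: ifP => // /imsetP[l lS].
  case/e_inj => [[ki _]|[kl _]]; first by rewrite -ki kr in ir.
  by rewrite -kl (negPf (rS _ kr)) in lS.
congr (nat_of_bool (_ == _)); rewrite (bigID (mem S)) /= addrC; congr (_ + _).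
  apply: eq_bigr => j jS; rewrite ffunE; case: ifP => // /imsetP[l lS].
  by move=> /e_injr jl; rewrite jl lS in jS.
by apply: eq_bigr => j jS; rewrite ffunE imset_f.
Qed.

Lemma mean_in_kernel_le_rows v (S : {set 'I_m}) (rho : R) : 0 <= rho ->
  (forall a i, mean (fun t : {ffun I -> bool} =>
     (a + \sum_(j in S) sgnb _ (t (e i j)) * v j == 0)%:R) <= rho) ->
  mean (fun t => (in_kernel v t)%:R) <= rho ^+ #|~: S|%SET.
Proof.
move=> rho0 rhoP; rewrite cardE.
apply: le_trans (mean_rows_le rho0 (enum_uniq (mem (~: S)%SET)) _ rhoP).
  apply: ler_mean => t; rewrite ler_nat; case: (boolP (in_kernel v t)) => // /forallP h.
  by rewrite lt0b; apply/allP => i _; apply: h.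
by move=> i; rewrite mem_enum inE.
Qed.

Lemma mean_in_kernel_le_cosmass v (S : {set 'I_m}) :
  mean (fun t => (in_kernel v t)%:R) <= (cosmass R v S / p%:R) ^+ #|~: S|%SET.
Proof.
apply: mean_in_kernel_le_rows.
  by rewrite divr_ge0 // cosmass_ge0.
move=> a i; apply: (mean_walk_le R p_pr p_gt2 (e := e i)).
by move=> j k _ _; apply: e_injr.
Qed.

(** One nonzero [v i] suffices: [a + v i] and [a - v i] cannot both vanish because [2 * v i] is
    nonzero, so every row other than the [i]-th costs a factor 1/2. *)
Lemma mean_in_kernel_le_half v : v != 0 ->
  mean (fun t => (in_kernel v t)%:R) <= 2^-1 ^+ m.-1 :> R.
Proof.
move=> v0; have [i vi] : exists i, v i != 0.
  apply/existsP; apply: contraNT v0; rewrite negb_exists => /forallP h.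
  by apply/eqP/ffunP => i; rewrite ffunE; apply/eqP; rewrite -[_ == _]negbK.
have -> : m.-1 = #|~: [set i]|%SET by rewrite cardsC1 card_ord.
apply: mean_in_kernel_le_rows => // a k.
rewrite (eq_mean (h := fun t => (a + sgnb _ (t (e k i)) * v i == 0)%:R)).
  rewrite (mean_coord bool0 (e k i) (fun b => (a + sgnb _ b * v i == 0)%:R)).
  rewrite big_bool card_bool /sgnb expr0 expr1 mul1r mulN1r.
  case: eqP => h1; case: eqP => h2 /=; rewrite ?addr0 ?add0r ?mul0r ?mul1r ?invr_ge0 //.
  suff : v i * 2%:R == 0.
    rewrite mulf_eq0 (negPf vi) -(dvdn_pcharf (pchar_Fp p_pr)).
    by move/dvdn_leq; lia.
  have -> : v i * 2%:R = (a + v i) - (a - v i) by ring.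
  by rewrite h1 h2 subrr.
by move=> t; rewrite big_set1.
Qed.

(** Union bound over the greedy sets [S] and the vectors structured with respect to [S]. The two
    summands of [term] pay for the vectors supported in [S] and for those with few heavy values. *)
Lemma mean_exists_structured_le s (Q : pred {ffun 'I_m -> 'F_p}) :
  (forall v, Q v -> [/\ v != 0, 4 < cosmass R v [set: 'I_m]%SET &
     (1 - (2 ^+ 17)^-1) ^+ s * p%:R < cosmass R v [set: 'I_m]%SET]) ->
  mean (fun t => [exists v, Q v && in_kernel v t]%:R) <=
    3 * ((m.+1 * (4 * p)) ^ s)%:R / 2 ^+ m :> R.
Proof.
move=> QP; have p0 : 0 < p%:R :> R by rewrite ltr0n prime_gt0.
pose off (S : {set 'I_m}) (G : {set 'F_p}) v : R :=
  [forall i, (i \notin S) ==> (v i \in G)]%:R.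
(* Emptying the set where it is too large makes [#|G S v| * W S v <= 1/4] hold for every [v], as
   [sum_structured_le] demands. *)
pose G S v := if #|heavy (cosprod R v S)|%:R * cosmass R v S <= p%:R / 4
  then heavy (cosprod R v S) else finset.set0.
pose W S v := cosmass R v S / p%:R.
pose term S v := off S [set 0]%SET v * 2^-1 ^+ m.-1 +
  off S (G S v) v * W S v ^+ #|~: S|%SET.
have W0 S v : 0 <= W S v by rewrite divr_ge0 // cosmass_ge0.
have term0 S v : 0 <= term S v.
  by rewrite addr_ge0 // mulr_ge0 // exprn_ge0 // invr_ge0.
have small (S : {set 'I_m}) : (#|S| <= s)%N -> \sum_v term S v <= 3 * (4 * p%:R) ^+ s / 2 ^+ m.
  move=> Ss; rewrite big_split /=.
  have p1 : 1 <= p%:R :> R by rewrite ler1n prime_gt0.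
  have F0 : (0 < #|{: 'F_p}|)%N by rewrite card_Fp // prime_gt0.
  have half_m : 2^-1 ^+ m.-1 <= 2 / 2 ^+ m :> R.
    case: m => [|k]; first by rewrite !expr0; lra.
    by rewrite /= exprS invfM mulrA divff // mul1r exprVn.
  have h1 : \sum_v off S [set 0]%SET v * 2^-1 ^+ m.-1 <= p%:R ^+ s * (2 / 2 ^+ m).
    rewrite -mulr_suml ler_pM ?sumr_ge0 ?exprn_ge0 ?invr_ge0 //.
    apply: (@le_trans _ _ (\sum_v off S [set 0]%SET v * 1 ^+ #|~: S|%SET)).
      by apply: ler_sum => v _; rewrite expr1n mulr1.
    apply: le_trans (sum_structured_le (S := S) (G := fun=> [set 0]%SET)
      (w := fun=> 1) (c := 1) _ _ _ F0) _ => //.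
      by move=> v; rewrite cards1 mulr1.
    by rewrite expr1n mulr1 card_Fp // ler_weXn2l.
  have h2 : \sum_v off S (G S v) v * W S v ^+ #|~: S|%SET <=
      p%:R ^+ s * (4 ^+ s / 4 ^+ m).
    have := @sum_structured_le R _ 'F_p S (G S) (W S) (4^-1); rewrite /off => h.
    apply: le_trans (h _ _ _ _) _ => //.
    - by move=> u v uv; rewrite /G /W (eq_heavy R uv) (eq_cosmass R uv).
    - move=> v; rewrite /G /W; case: ifP => [h4|_].
        by rewrite mulrA ler_pdivrMr //; lra.
      by rewrite cards0 mul0r invr_ge0.
    rewrite card_Fp // ler_pM ?exprn_ge0 ?invr_ge0 //; first exact: ler_weXn2l.
    (* The coordinates in [S] bring no factor 1/4; these at most [s] missing factors cost
       [4 ^+ s]. *)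
    have -> : 4 ^+ m = 4 ^+ #|S| * 4 ^+ #|~: S|%SET :> R.
      by rewrite -exprD cardsC card_ord.
    rewrite exprVn invfM mulrA.
    rewrite ler_peMl ?invr_ge0 ?exprn_ge0 // ler_pdivlMr ?exprn_gt0 // mul1r.
    by rewrite ler_weXn2l // ler1n.
  apply: le_trans (lerD h1 h2) _; rewrite exprMn.
  have ps : 0 <= p%:R ^+ s :> R by rewrite exprn_ge0.
  have : 1 <= 4 ^+ s :> R by rewrite exprn_ege1 // ler1n.
  have : (4 ^+ m)^-1 <= (2 ^+ m)^-1 :> R.
    rewrite lef_pV2 ?posrE ?exprn_gt0 // lerXn2r ?nnegrE // ?ler0n //; lra.
  have : 0 <= (2 ^+ m)^-1 :> R by rewrite invr_ge0 exprn_ge0.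
  move: ((4 ^+ m)^-1 : R) ((2 ^+ m)^-1 : R) (4 ^+ s : R) => a b c b0 ab c1.
  rewrite [leRHS](_ : _ = p%:R ^+ s * (3 * c * b)); last by ring.
  by rewrite -mulrDr ler_wpM2l //; nra.
apply: (@le_trans _ _ (\sum_(S : {set 'I_m} | (#|S| <= s)%N) \sum_v term S v)).
  apply: (@le_trans _ _ (\sum_(S : {set 'I_m} | (#|S| <= s)%N) \sum_(v | Q v &&
      [forall i, (i \notin S) ==> (v i \in heavy (cosprod R v S))])
    mean (fun t => (in_kernel v t)%:R))).
    under eq_bigr do rewrite -mean_sum; rewrite -mean_sum; apply: ler_mean => t.
    case: existsP => [[v /andP[Qv vt]]|_]; last by do 2 apply: sumr_ge0 => ? _.
    have [v0 v4 vs] := QP v Qv.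
    have [S [Ss SP]] := heavy_structure p_pr vs.
    rewrite (bigD1 S) //= (bigD1 v) /=; last first.
      by rewrite Qv; apply/forallP => i; apply/implyP; apply: SP.
    rewrite vt -addrA lerDl; rewrite addr_ge0 //; do ?apply: sumr_ge0 => ? _ //.
  apply: ler_sum => S _; rewrite [leLHS]big_mkcond; apply: ler_sum => v _.
  case: ifP => // /andP[Qv heavyP]; have [v0 v4 vs] := QP v Qv.
  have v4S : 4 < \sum_x cosprod R v S x.
    exact: lt_le_trans v4 (cosmass_mono R v (finset.subsetT S)).
  case: (heavy_or_trivial p_pr p_gt2 (cosprod_ge0 R v S) (cosprod_le1 R v S) v4S) => h.
    apply: le_trans (mean_in_kernel_le_half v0) _.
    rewrite /term /off; case: forallP => [_|[]].
      by rewrite mul1r lerDl mulr_ge0 // exprn_ge0.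
    by move=> i; apply/implyP => iS; rewrite inE (h (v i)) // (implyP (forallP heavyP i)).
  apply: le_trans (mean_in_kernel_le_cosmass v S) _.
  rewrite /term /off /G h heavyP mul1r lerDr mulr_ge0 // exprn_ge0 // invr_ge0 //.
apply: (@le_trans _ _ (\sum_(S : {set 'I_m} | (#|S| <= s)%N)
    3 * (4 * p%:R) ^+ s / 2 ^+ m)); first exact: ler_sum.
rewrite sumr_const -[leLHS]mulr_natl.
rewrite [leRHS](_ : _ = m.+1%:R ^+ s * (3 * (4 * p%:R) ^+ s / 2 ^+ m)); last first.
  by rewrite natrX !natrM exprMn; ring.
rewrite ler_wpM2r ?divr_ge0 ?mulr_ge0 ?exprn_ge0 ?mulr_ge0 // -natrX ler_nat.
have := card_small_sets 'I_m s; rewrite card_ord cardsE; exact.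
Qed.

End SymmetricKernel.

(** * Kernel vectors modulo a prime *)

(** The row is read as a polynomial, so that [rat_poly_scale] clears denominators and [zprimitive]
    removes the content; what remains has content 1, which [p] does not divide. *)
Lemma primitive_multiple m (u : 'rV[rat]_m) (p : nat) : (1 < p)%N -> u != 0 ->
  exists (a : 'I_m -> int) (k : rat), [/\ k != 0,
    forall i, u 0 i = k * (a i)%:~R & exists i, ~~ (p%:Z %| a i)%Z].
Proof.
move=> p_gt1 u0; have [q [d d0 uq]] := rat_poly_scale (rVpoly u).
have u0' : rVpoly u != 0.
  by apply: contra_neq u0 => u0; rewrite -[u]rVpolyK u0 raddf0.
have q0 : q != 0.
  by apply: contra_neq u0' => q0; rewrite uq q0 rmorph0 scaler0.
have u_coef (i : 'I_m) : u 0 i = (zcontents q)%:~R / d%:~R * ((zprimitive q)`_i)%:~R.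
  have -> : u 0 i = (rVpoly u)`_i by rewrite coef_rVpoly_ord.
  rewrite uq coefZ coef_map /= {1}[q]zpolyEprim coefZ rmorphM /=; ring.
exists (fun i => (zprimitive q)`_i), ((zcontents q)%:~R / d%:~R); split => //.
  by rewrite mulf_neq0 ?invr_eq0 ?intr_eq0 ?zcontents_eq0.
apply/existsP; apply: contraT; rewrite negb_exists => /forallP h.
have : (p%:Z %| zcontents (zprimitive q))%Z.
  rewrite dvdz_contents; apply/polyOverP => i.
  have [lt_i|ge_i] := ltnP i m.
    by have := h (Ordinal lt_i); rewrite negbK.
  suff -> : (zprimitive q)`_i = 0 by rewrite dvdz0.
  have : (rVpoly u)`_i = 0 by rewrite coef_poly ltnNge ge_i.
  rewrite uq coefZ coef_map /= => /eqP; rewrite mulf_eq0 invr_eq0 !intr_eq0 (negPf d0) /=.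
  by rewrite {1}[q]zpolyEprim coefZ mulf_eq0 zcontents_eq0 (negPf q0) => /eqP.
rewrite zcontents_primitive q0 => /dvdzP[z] /(congr1 absz).
by rewrite abszM /= => /esym/eqP; rewrite muln_eq1 => /andP[_ /eqP]; lia.
Qed.

(* A kernel vector of the bordered matrix either has zero first entry, and then
   restricts to a multiple of [u], or expresses the first row as a combination
   of the rows of the corank-one block, all of which are orthogonal to [u]. *)
Lemma border_orthogonal (K : fieldType) m (A : 'M[K]_m.+1) (u : 'rV[K]_m) :
  A^T = A -> \det A = 0 -> \rank (row' ord0 (col' ord0 A)) = m.-1 ->
  u != 0 -> u *m row' ord0 (col' ord0 A) = 0 ->
  \sum_j A ord0 (lift ord0 j) * u 0 j = 0.
Proof.
set B := row' _ _ => symA detA rankB u0 uB.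
have Asym i j : A i j = A j i by rewrite -[in LHS]symA mxE.
have [w w0 wA] : exists2 w : 'rV_m.+1, w != 0 & w *m A = 0.
  by apply/det0P; rewrite detA.
pose w' : 'rV_m := \row_j w 0 (lift ord0 j).
have wAE j : w 0 ord0 * A ord0 j + \sum_k w' 0 k * A (lift ord0 k) j = 0.
  transitivity ((w *m A) 0 j); last by rewrite wA mxE.
  by rewrite mxE big_ord_recl; congr (_ + _); apply: eq_bigr => k _; rewrite mxE.
have [w00|w00] := eqVneq (w 0 ord0) 0.
  have w'B : w' *m B = 0.
    apply/rowP => j; rewrite !mxE -[RHS](wAE (lift ord0 j)) w00 mul0r add0r.
    by apply: eq_bigr => k _; rewrite !mxE.
  have w'0 : w' != 0.
    apply: contra_neq w0 => w'0; apply/rowP => j; rewrite mxE.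
    case: (unliftP ord0 j) => [k ->|-> //].
    by have := congr1 (fun X : 'rV_m => X 0 k) w'0; rewrite !mxE.
  have m_gt0 : (0 < m)%N.
    rewrite lt0n; apply: contraNneq u0 => m0; apply/eqP/rowP => i.
    by have := ltn_ord i; rewrite [X in (_ < X)%N]m0.
  have kerBu : (kermx B <= u)%MS.
    have uker : (u <= kermx B)%MS by rewrite sub_kermx uB.
    rewrite -(geq_leqif (mxrank_leqif_sup uker)) mxrank_ker rankB rank_rV u0; lia.
  have /sub_rVP[k w'E] : (w' <= u)%MS.
    by apply: submx_trans kerBu; rewrite sub_kermx w'B.
  have k0 : k != 0 by apply: contra_neq w'0 => k0; rewrite w'E k0 scale0r.
  apply: (mulfI k0); rewrite mulr0 -[RHS](wAE ord0) w00 mul0r add0r mulr_sumr.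
  by apply: eq_bigr => j _; rewrite w'E mxE (Asym ord0); ring.
apply: (mulfI w00); rewrite mulr0 mulr_sumr.
rewrite (eq_bigr (fun j => - \sum_k w' 0 k * (A (lift ord0 k) (lift ord0 j) * u 0 j))).
  rewrite sumrN exchange_big big1 ?oppr0 // => k _ /=; rewrite -mulr_sumr.
  rewrite [X in _ * X](_ : _ = (u *m B) 0 k); first by rewrite uB [X in _ * X]mxE mulr0.
  by rewrite mxE; apply: eq_bigr => j _; rewrite !mxE Asym mulrC.
move=> j _; have /eqP := wAE (lift ord0 j); rewrite addr_eq0 => /eqP E.
by rewrite mulrA E mulNr mulr_suml; congr (- _); apply: eq_bigr => k _; ring.
Qed.

(** The rank may drop modulo [p], so the kernel vector is taken over the rationals, scaled to an
    integer vector not divisible by [p], and only then reduced. Its orthogonality relations with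
    integer rows survive the reduction. *)
Lemma kernel_mod_p (F : numFieldType) m (B : 'M[int]_m) (p : nat) : prime p ->
  (0 < m)%N -> \rank (map_mx intr B : 'M[F]_m) = m.-1 ->
  exists v : {ffun 'I_m -> 'F_p}, [/\ v != 0,
    forall i, B^T = B -> \sum_j (B i j)%:~R * v j = 0 &
    forall A : 'M[int]_m.+1, A^T = A -> row' ord0 (col' ord0 A) = B -> \det A = 0 ->
      \sum_j (A ord0 (lift ord0 j))%:~R * v j = 0].
Proof.
move=> p_pr m_gt0 rankF.
pose BQ : 'M[rat]_m := map_mx intr B.
have rankB : \rank BQ = m.-1.
  rewrite -rankF -[LHS](mxrank_map (@ratr F)) -map_mx_comp; congr mxrank.
  by apply/matrixP => i j; rewrite !mxE /= ratr_int.
have kerB0 : kermx BQ != 0 by rewrite -mxrank_eq0 mxrank_ker rankB; lia.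
pose u := nz_row (kermx BQ).
have u0 : u != 0 by rewrite nz_row_eq0.
have uB : u *m BQ = 0 by apply/eqP; rewrite -sub_kermx nz_row_sub.
have [a [k [k0 ua [i0 pa]]]] := primitive_multiple (prime_gt1 p_pr) u0.
have modp (x : 'I_m -> int) : \sum_j (x j)%:~R * u 0 j = 0 ->
    \sum_j (x j)%:~R * (a j)%:~R = 0 :> 'F_p.
  move=> xu; suff xa : \sum_j x j * a j = 0.
    transitivity ((\sum_j x j * a j)%:~R : 'F_p); last by rewrite xa.
    by rewrite rmorph_sum; apply: eq_bigr => j _; rewrite rmorphM.
  apply: (@intr_inj rat); rewrite rmorph0 rmorph_sum /=; apply: (mulfI k0).
  rewrite mulr0 mulr_sumr -[RHS]xu; apply: eq_bigr => j _.
  by rewrite ua rmorphM /=; ring.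
exists [ffun j => (a j)%:~R]; split.
- apply: contraNneq pa => /ffunP/(_ i0); rewrite !ffunE => /eqP.
  by rewrite -(dvdz_pcharf (pchar_Fp p_pr)).
- move=> i Bsym; rewrite -[RHS](modp (fun j => B i j)).
    by apply: eq_bigr => j _; rewrite ffunE.
  transitivity ((u *m BQ) 0 i); last by rewrite uB mxE.
  by rewrite mxE; apply: eq_bigr => j _; rewrite mxE -[in LHS]Bsym mxE mulrC.
move=> A Asym AB detA; rewrite -[RHS](modp (fun j => A ord0 (lift ord0 j))).
  by apply: eq_bigr => j _; rewrite ffunE.
pose AQ : 'M[rat]_m.+1 := map_mx intr A.
have AQB : row' ord0 (col' ord0 AQ) = BQ.
  by rewrite /BQ -AB; apply/matrixP => i j; rewrite !mxE.
have := @border_orthogonal _ _ AQ u; rewrite AQB; under eq_bigr do rewrite mxE.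
apply=> //; first by rewrite /AQ map_trmx Asym.
by rewrite det_map_mx detA.
Qed.

(** * The counting bound *)

Definition upper n := {x : 'I_n * 'I_n | (x.1 <= x.2)%N}.

Lemma upair_subproof n (i j : 'I_n) :
  let x := if (i <= j)%N then (i, j) else (j, i) in (x.1 <= x.2)%N.
Proof. by case: ltnP => //= /ltnW. Qed.

Definition upair n (i j : 'I_n) : upper n :=
  exist (fun x : 'I_n * 'I_n => (x.1 <= x.2)%N) _ (upair_subproof i j).

Lemma upairC n (i j : 'I_n) : upair i j = upair j i.
Proof.
apply: val_inj => /=; case: (ltngtP i j) => [|| /val_inj ->] //.
Qed.

Lemma upair_inj n (i j k l : 'I_n) : upair i j = upair k l ->
  i = k /\ j = l \/ i = l /\ j = k.
Proof.
move/(congr1 val) => /=.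
by case: ifP => _; case: ifP => _ [-> ->]; [left|right|right|left].
Qed.

Definition sign_mx n (t : {ffun upper n -> bool}) : 'M[int]_n :=
  \matrix_(i, j) sgnb int (t (upair i j)).

Lemma sign_mx_sym n (t : {ffun upper n -> bool}) : (sign_mx t)^T = sign_mx t.
Proof. by apply/matrixP => i j; rewrite !mxE upairC. Qed.

Section FiniteBound.
Variables (R : realType) (p : nat).
Hypothesis p_pr : prime p.
Hypothesis p_gt2 : (2 < p)%N.
Variable m : nat.
Hypothesis m_gt0 : (0 < m)%N.

Definition corank_one_singular (t : {ffun upper m.+1 -> bool}) : bool :=
  (\det (sign_mx t) == 0) &&
  (\rank (map_mx intr (row' ord0 (col' ord0 (sign_mx t))) : 'M[R]_m) == m.-1).

(** Conditioning on the block: the first term bounds the probability that it has a kernel vector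
    with concentration at least [eps]; otherwise a fresh first row is orthogonal to the chosen
    kernel vector with probability at most [eps]. *)
Lemma mean_corank_one_singular_le s (eps : R) :
  4 < eps * p%:R -> (1 - (2 ^+ 17)^-1) ^+ s < eps ->
  mean (fun t => (corank_one_singular t)%:R) <=
    3 * ((m.+1 * (4 * p)) ^ s)%:R / 2 ^+ m + eps.
Proof.
move=> eps4 eps_s; have p0 : 0 < p%:R :> R by rewrite ltr0n prime_gt0.
have eps0 : 0 < eps by rewrite -(pmulr_lgt0 _ p0); apply: lt_trans eps4.
have bool0 : (0 < #|{: bool}|)%N by rewrite card_bool.
pose e (i j : 'I_m) := upair (lift ord0 i) (lift ord0 j).
have e_inj i j k l : e i j = e k l -> i = k /\ j = l \/ i = l /\ j = k.
  by case/upair_inj => -[/lift_inj -> /lift_inj ->]; [left|right].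
pose Q (v : {ffun 'I_m -> 'F_p}) := (v != 0) && (eps * p%:R <= cosmass R v [set: 'I_m]%SET).
have QP v : Q v -> [/\ v != 0, 4 < cosmass R v [set: 'I_m]%SET &
     (1 - (2 ^+ 17)^-1) ^+ s * p%:R < cosmass R v [set: 'I_m]%SET].
  case/andP=> v0 big; split => //; first exact: lt_le_trans big.
  by apply: lt_le_trans big; rewrite ltr_pM2r.
apply: le_trans (lerD (mean_exists_structured_le p_pr p_gt2 e_inj QP) (lexx eps)).
pose first (j : 'I_m) : upper m.+1 := upair ord0 (lift ord0 j).
have first_inj : injective first.
  by move=> j k; rewrite /first => /upair_inj[[_ /lift_inj]|[]].
(* Only the off-diagonal entries of the first row are resampled, so the block and its kernel vector
   are fixed by [t]. *)
rewrite (mean_mix bool0 [set first j | j : 'I_m]%SET).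
rewrite -[X in _ <= _ + X](@mean_cst R (upper m.+1) _ bool0).
rewrite -meanD; apply: ler_mean => t.
set D := [set first j | j : 'I_m]%SET.
set B := row' ord0 (col' ord0 (sign_mx t)).
have BE u : row' ord0 (col' ord0 (sign_mx (mix D t u))) = B.
  apply/matrixP => i j; rewrite !mxE ffunE; case: ifP => // /imsetP[k _].
  by rewrite /first => /upair_inj[] [].
have [rankB|rankB] := eqVneq (\rank (map_mx intr B : 'M[R]_m)) m.-1; last first.
  rewrite (eq_mean (h := fun=> 0)) ?mean_cst // => [|u]; first by rewrite addr_ge0 // ltW.
  by rewrite /corank_one_singular BE (negPf rankB) andbF.
have [v [v0 vB vA]] := kernel_mod_p p_pr m_gt0 rankB.
have signE (F : pzRingType) b : (sgnb int b)%:~R = sgnb F b.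
  by rewrite /sgnb rmorphXn rmorphN1.
have Bsym : B^T = B by apply/matrixP => i j; rewrite !mxE upairC.
have v_ker : in_kernel e v t.
  apply/forallP => i; rewrite /row_vanishes; apply/eqP; rewrite -[RHS](vB i Bsym).
  by apply: eq_bigr => j _; rewrite !mxE signE.
have [big|small] := leP (eps * p%:R) (cosmass R v [set: 'I_m]%SET).
  rewrite (_ : [exists v, _]); last first.
    by apply/existsP; exists v; rewrite /Q v0 big v_ker.
  apply: (@le_trans _ _ (mean (I := upper m.+1) (T := bool) (fun=> 1))); last first.
    by rewrite mean_cst // lerDl ltW.
  apply: ler_mean => u.
  by rewrite lern1 leq_b1.
apply: (@le_trans _ _ eps); last by rewrite lerDr.
apply: (@le_trans _ _ (cosmass R v [set: 'I_m]%SET / p%:R)); last first.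
  by rewrite ler_pdivrMr // ltW.
have := @mean_walk_le R p p_pr p_gt2 _ _ first v [set: 'I_m]%SET 0.
move=> /(_ (in2W first_inj)); apply: le_trans; apply: ler_mean => u.
rewrite ler_nat; case: (boolP (corank_one_singular _)) => // /andP[/eqP detA _].
rewrite add0r lt0b; apply/eqP; rewrite -[RHS](vA _ (sign_mx_sym _) (BE u) detA).
apply: eq_big => [j|j _]; first by rewrite inE.
have jD : first j \in D by apply: imset_f.
by rewrite !mxE signE ffunE jD.
Qed.

End FiniteBound.

(** [L ^ 3 <= 27 * 2 ^ L] settles [L > 27 * A], and the finitely many smaller [L] are absorbed by
    [D]. *)
Lemma expn2_dominates_sqr A : exists D, forall L, (A * L ^ 2 <= 2 ^ L + D)%N.
Proof.
exists (A * (27 * A) ^ 2)%N => L.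
have [small|large] := leqP L (27 * A).
  by apply: leq_trans (leq_addl _ _); rewrite leq_mul2l leq_exp2r ?small ?orbT.
apply: leq_trans (leq_addr _ _).
have L3 : (L <= 3 * 2 ^ (L %/ 3))%N.
  have := divn_eq L 3; have := ltn_pmod L (isT : 0 < 3)%N.
  by have := ltn_expl (L %/ 3) (isT : 1 < 2)%N; lia.
have : (L ^ 3 <= 27 * 2 ^ L)%N.
  apply: (@leq_trans ((3 * 2 ^ (L %/ 3)) ^ 3)%N); first by rewrite leq_exp2r.
  rewrite expnMn -expnM leq_mul2l leq_exp2l //= leq_divM //.
have : (27 * (A * L ^ 2) <= L ^ 3)%N.
  by rewrite mulnA [(L ^ 3)%N]expnS leq_mul2r (ltnW large) orbT.
lia.
Qed.

(** Bernoulli's inequality gives [(1 + 1/k) ^ k >= 2], while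
    [(1 - 1/k) ^ k * (1 + 1/k) ^ k <= 1]. *)
Lemma expr_1subV_le_half (R : realFieldType) k : (0 < k)%N ->
  (1 - k%:R^-1) ^+ k <= 2^-1 :> R.
Proof.
move=> k0; have k0' : 0 < k%:R :> R by rewrite ltr0n.
set x : R := k%:R^-1; have x0 : 0 < x by rewrite invr_gt0.
have x1 : x <= 1 by rewrite invf_le1 // ler1n.
have bern j : 1 + j%:R * x <= (1 + x) ^+ j.
  elim: j => [|j IH]; first by rewrite mul0r addr0 expr0.
  rewrite exprS -natr1; have : 0 <= j%:R :> R by [].
  by move: (j%:R : R) ((1 + x) ^+ j) IH => y z; nra.
have := bern k; rewrite divff ?gt_eqF // => h.
have : (1 - x) ^+ k * (1 + x) ^+ k <= 1.
  by rewrite -exprMn exprn_ile1 //; nra.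
have : 0 <= (1 - x) ^+ k by rewrite exprn_ge0 // subr_ge0.
move: ((1 - x) ^+ k) ((1 + x) ^+ k) h => a b; nra.
Qed.

Lemma mean_corank_one_singular_asymptotic (R : realType) (c : nat) : (0 < c)%N ->
  exists K : R, 0 < K /\ forall m, (0 < m)%N ->
    mean (fun t => (corank_one_singular R (m := m) t)%:R) <= K / m.+1%:R ^+ c.
Proof.
move=> c0; set k := (2 ^ 17)%N.
have k0 : (0 < k)%N by rewrite expn_gt0.
have kE : k%:R = 2 ^+ 17 :> R by rewrite natrX.
clearbody k.
(* [A * L ^ 2] will bound the exponent of 2 in [(n * (4 * p)) ^ s * n ^ c]. It is doubled below
   because [2 ^ L] can be as large as [2 * n]. *)
pose A := ((2 * c + 10) * (k * c) + c)%N.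
have [D DP] := expn2_dominates_sqr (2 * A).
(* The exponent [D.+1] makes up for [n = m.+1], and the last 1 pays for [eps = n ^- c]. *)
exists (3 * 2 ^+ D.+1 + 1); split; first by rewrite ltr_wpDl // mulr_ge0 // exprn_ge0.
move=> m m0; pose n := m.+1.
pose L := (trunc_log 2 n).+1.
have nL : (n < 2 ^ L)%N by apply: trunc_log_ltn.
have Ln : (2 ^ L.-1 <= n)%N by apply: trunc_logP.
(* A prime [p > 4 * n ^ c] gives [eps * p > 4] for [eps = n ^- c]; the summand 3 ensures
   [7 <= N]. *)
pose N := (4 * n ^ c + 3)%N.
have nc1 : (0 < n ^ c)%N by rewrite expn_gt0.
have N7 : (7 <= N)%N by rewrite /N; lia.
have [p [p_pr pN p_le]] := exists_prime_between N7.
have p_gt2 : (2 < p)%N by lia.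
have n0 : 0 < n%:R ^+ c :> R by rewrite exprn_gt0 // ltr0n.
(* Every [k] steps gain at least a factor 2, and [c * L] such gains go below [n ^- c]. *)
pose s := (k * (c * L))%N.
have eps4 : 4 < (n%:R ^+ c)^-1 * p%:R :> R.
  rewrite mulrC ltr_pdivlMr // -natrX -natrM ltr_nat; lia.
have eps_s : (1 - (2 ^+ 17)^-1) ^+ s < (n%:R ^+ c)^-1 :> R.
  rewrite /s exprM -kE.
  have h := expr_1subV_le_half R k0.
  have h0 : 0 <= (1 - k%:R^-1) ^+ k :> R.
    by rewrite exprn_ge0 // subr_ge0 invf_le1 ?ler1n // ltr0n.
  apply: (@le_lt_trans _ _ (2^-1 ^+ (c * L))).
    by rewrite lerXn2r // nnegrE.
  rewrite exprVn ltf_pV2 ?posrE ?exprn_gt0 // mulnC exprM -!natrX ltr_nat.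
  by rewrite ltn_exp2r.
apply: le_trans (mean_corank_one_singular_le p_pr p_gt2 m0 eps4 eps_s) _.
rewrite -/n.
rewrite [leRHS]mulrDl [1 / _]mul1r lerD2r.
rewrite ler_pdivrMr ?exprn_gt0 // mulrAC ler_pdivlMr // -!mulrA ler_pM2l //.
rewrite -!natrX -!natrM ler_nat.
have base : (n * (4 * p) <= 2 ^ (L * (2 * c + 10)))%N.
  have p98 : (p <= 98 * (n ^ c) ^ 2)%N.
    by apply: leq_trans p_le _; rewrite /N -!mulnn; nia.
  apply: (@leq_trans (2 ^ 9 * n ^ (2 * c + 1)))%N.
    have -> : (n ^ (2 * c + 1) = n * (n ^ c) ^ 2)%N.
      by rewrite -expnM -expnS addn1 [(c * 2)%N]mulnC.
    move: ((n ^ c) ^ 2)%N p98 => y.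
    by have -> : (2 ^ 9 = 512)%N by []; nia.
  apply: (@leq_trans (2 ^ (L * 9) * 2 ^ (L * (2 * c + 1))))%N.
    rewrite leq_mul // ?leq_exp2l ?leq_pmull //.
    by rewrite [(2 ^ (L * _))%N]expnM leq_exp2r ?(ltnW nL) // addn1.
  by rewrite -expnD leq_exp2l //; lia.
apply: (@leq_trans ((2 ^ (L * (2 * c + 10))) ^ s * 2 ^ (L * c)))%N.
  rewrite leq_mul //.
    by case: (s) => // s'; rewrite leq_exp2r.
  by rewrite expnM leq_exp2r // ltnW.
rewrite -expnM -!expnD leq_exp2l //.
have := DP L; rewrite /A /s.
have -> : (2 ^ L = 2 * 2 ^ L.-1)%N by rewrite -expnS.
have : (L * c <= c * (L * L))%N by rewrite mulnC leq_mul2l leq_pmull // orbT.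
have -> : (L * (2 * c + 10) * (k * (c * L)) = (2 * c + 10) * (k * c) * (L * L))%N.
  by ring.
rewrite -mulnn; set X := ((2 * c + 10) * (k * c))%N.
have -> : (2 * (X + c) * (L * L) = 2 * (X * (L * L)) + 2 * (c * (L * L)))%N by ring.
move: (2 ^ L.-1)%N Ln => y; rewrite /n; move: (X * (L * L))%N (c * (L * L))%N; lia.
Qed.

(** * From sign patterns to random variables *)

Lemma rank_mxsub_le (K : fieldType) m k (A : 'M[K]_m) (f g : 'I_k -> 'I_m) :
  (\rank (mxsub f g A) <= \rank A)%N.
Proof.
have -> : mxsub f g A = rowsub f (colsub g A) by apply/matrixP => i j; rewrite !mxE.
apply: leq_trans (mxrankS (rowsub_sub _ _)) _.
have -> : colsub g A = (rowsub g A^T)^T by apply/matrixP => i j; rewrite !mxE.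
by rewrite mxrank_tr -(mxrank_tr A) mxrankS // rowsub_sub.
Qed.

Lemma exists_maximal_minor (K : fieldType) m (A : 'M[K]_m) :
  exists f g : 'I_(\rank A) -> 'I_m, \det (mxsub f g A) != 0.
Proof.
pose B := rowsub (maxrankfun A) A.
have Bfull : row_full B^T.
  by rewrite /row_full mxrank_tr; exact: maxrowsub_free.
exists (maxrankfun A), (fullrankfun Bfull).
rewrite -unitfE -unitmxE -unitmx_tr.
have -> : (mxsub (maxrankfun A) (fullrankfun Bfull) A)^T = rowsub (fullrankfun Bfull) B^T.
  by apply/matrixP => i j; rewrite !mxE.
exact: fullrowsub_unit.
Qed.

Section Measurability.
Variables (R : realType) (d : measure_display) (T : measurableType d).

Lemma measurable_det n (F : T -> 'M[R]_n) :
  (forall i j, measurable_fun setT (fun w => F w i j)) ->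
  measurable_fun setT (fun w => \det (F w)).
Proof.
move=> mF; rewrite /determinant; apply: measurable_sum => s.
by apply: measurable_realfun.measurable_funM => //; apply: measurable_prod.
Qed.

Lemma measurable_det_eq0 n (F : T -> 'M[R]_n) :
  (forall i j, measurable_fun setT (fun w => F w i j)) ->
  measurable [set w | \det (F w) = 0].
Proof.
move=> mF; rewrite -[X in measurable X]setTI.
exact: (measurable_det mF measurableT (measurable_set1 0)).
Qed.

(** The rank is [k] when some minor of size [k] is nonzero and no larger one is; minors are
    measurable as polynomials in the entries. *)
Lemma measurable_rank_eq m (F : T -> 'M[R]_m) k :
  (forall i j, measurable_fun setT (fun w => F w i j)) ->
  measurable [set w | \rank (F w) = k].
Proof.
move=> mF; pose minor j (fg : {ffun 'I_j -> 'I_m} * {ffun 'I_j -> 'I_m}) :=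
  ~` [set w | \det (mxsub fg.1 fg.2 (F w)) = 0].
pose S j := \bigcup_fg minor j fg.
have mS j : measurable (S j).
  apply: fin_bigcup_measurable; first exact: finite_finset.
  move=> fg _; apply: measurableC; apply: measurable_det_eq0 => a b.
  by under eq_fun do rewrite mxE; exact: mF.
have S_le j w : S j w -> (j <= \rank (F w))%N.
  case=> fg _ /eqP; rewrite -unitfE -unitmxE => /mxrank_unit {1}<-.
  exact: rank_mxsub_le.
have S_rank w : S (\rank (F w)) w.
  have [f [g fg]] := exists_maximal_minor (F w).
  exists ([ffun x => f x], [ffun x => g x]) => //=; apply/eqP.
  suff -> : mxsub [ffun x => f x] [ffun x => g x] (F w) = mxsub f g (F w) by [].
  by apply/matrixP => a b; rewrite !mxE !ffunE.
have -> : [set w | \rank (F w) = k] =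
    S k `\` \bigcup_(j in [set j : 'I_m.+1 | (k < j)%N]) S j.
  apply/seteqP; split => w /=.
    by move=> <-; split => // -[j /= kj /S_le]; rewrite leqNgt kj.
  case=> /S_le; rewrite leq_eqVlt => /orP[/eqP //|kr] [].
  by exists (inord (\rank (F w))); rewrite /= ?inordK // ltnS rank_leq_row.
apply: measurableD => //; apply: fin_bigcup_measurable; first exact: finite_finset.
by move=> j _.
Qed.

End Measurability.

Lemma card_upper n : #|[set x : 'I_n * 'I_n | (x.1 <= x.2)%N]%SET| = #|{: upper n}|.
Proof. by rewrite card_sig cardsE. Qed.

(** Up to null sets, [E] is covered by the patterns [t] with [bad t]; by independence each has
    probability [2 ^- #|upper n|], and subadditivity concludes. *)
Lemma probability_le_mean (R : realType) (d : measure_display)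
    (T : measurableType d) (P : probability T R) n
    (M : 'I_n -> 'I_n -> {RV P >-> R}) (E : set T)
    (bad : {ffun upper n -> bool} -> bool) :
  random_symmetric_bernoulli M -> measurable E ->
  (forall w (t : {ffun upper n -> bool}), E w ->
    (forall i j, M i j w = sgnb R (t (upair i j))) -> bad t) ->
  (P E <= (mean (fun t => (bad t)%:R : R))%:E)%E.
Proof.
move=> [Msym Mpm Mind] mE EP.
have mM i j (a : R) : measurable (M i j @^-1` [set a]).
  by apply: measurable_funPTI; exact: measurable_set1.
pose D := [set x : 'I_n * 'I_n | (x.1 <= x.2)%N]%SET.
pose val_of (t : {ffun upper n -> bool}) (x : 'I_n * 'I_n) : set R :=
  [set sgnb R (t (upair x.1 x.2))].
pose pat t : set T := [set w | forall x, x \in D -> val_of t x (M x.1 x.2 w)].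
pose atom (x : upper n) (a : R) : set T := M (val x).1 (val x).2 @^-1` [set a].
pose nul x : set T := ~` (atom x 1 `|` atom x (-1)).
(* Outside the null sets [nul x] every entry is a sign. *)
pose cov (z : {ffun upper n -> bool} + upper n) : set T :=
  match z with inl t => if bad t then pat t else set0 | inr x => nul x end.
have mpat t : measurable (pat t).
  have -> : pat t = \bigcap_(x in [set` D]) (M x.1 x.2 @^-1` val_of t x).
    by apply/seteqP; split.
  by apply: fin_bigcap_measurable; [exact: finite_finset|move=> x _; exact: mM].
have Ppat t : P (pat t) = (2^-1 ^+ #|{: upper n}|)%:E.
  rewrite Mind //; last by move=> x; apply: measurable_set1.
  rewrite (eq_bigr (fun=> (2^-1)%:E)); last first.
    move=> x; rewrite inE => /Mpm[P1 Pm1]; rewrite /val_of /sgnb.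
    by case: (t _); rewrite ?expr1 ?expr0.
  by rewrite prodEFin prodr_const card_upper.
have half2 : 2^-1 + 2^-1 = 1 :> R by field.
have Pnul x : P (nul x) = 0%E.
  have [P1 Pm1] : P (atom x 1) = (2^-1)%:E /\ P (atom x (-1)) = (2^-1)%:E.
    exact: Mpm _ _ (valP x).
  transitivity (1 - P (atom x 1%R `|` atom x (-1)%R))%E.
    by apply: probability_setC; apply: measurableU; exact: mM.
  have -> : P (atom x 1 `|` atom x (-1)) = (P (atom x 1%R) + P (atom x (-1)%R))%E.
    apply: measureU; [exact: mM|exact: mM|].
    apply/seteqP; split => // w []; rewrite /atom /= => -> h.
    by exfalso; clear -h; lra.
  by rewrite P1 Pm1 -EFinD half2; apply: (@subee _ 1%:E).
have Ecov : E `<=` \bigcup_(z in [set` enum {: {ffun upper n -> bool} + upper n}]) cov z.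
  move=> w Ew; have [[x xw]|allpm] := pselect (exists x, nul x w).
    by exists (inr x) => //=; rewrite mem_enum.
  pose t : {ffun upper n -> bool} := [ffun x => M (val x).1 (val x).2 w == -1].
  have tE (x : upper n) : M (val x).1 (val x).2 w = sgnb R (t x).
    rewrite ffunE /sgnb; case: eqP => [->|neq]; rewrite ?expr1 ?expr0 //.
    apply: contra_notP allpm => neq1; exists x; rewrite /nul /=.
    by move=> [].
  have MtE i j : M i j w = sgnb R (t (upair i j)).
    by rewrite -tE /=; case: leqP => //= _; rewrite Msym.
  exists (inl t); first by rewrite /= mem_enum.
  by rewrite /= (EP w t Ew MtE) => x _; rewrite /val_of /= MtE.
have mcov z : measurable (cov z).
  case: z => [t|x] /=; first by case: ifP.
  by apply: measurableC; apply: measurableU; apply: mM.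
apply: (@le_trans _ _
  (\sum_(z \in [set` enum {: {ffun upper n -> bool} + upper n}]) P (cov z))%E).
  by apply: content_sub_fsum.
rewrite -fsbig_seq ?enum_uniq // big_enum /= big_sumType /=.
rewrite [X in (_ + X)%E]big1 ?adde0 => [|x _]; last exact: Pnul.
rewrite /mean card_ffun card_bool mulr_suml -sumEFin.
apply: lee_sum => t _; case: (bad t); rewrite ?measure0 ?mul0r //.
by rewrite mul1r Ppat exprVn natrX.
Qed.

Theorem theorem2p5 (R : realType) (C : R) (C_gt0 : 0 < C) :
  exists K : R, 0 < K /\
    forall (n : nat) (n_ge2 : (2 <= n)%N)
      (d : measure_display) (T : measurableType d) (P : probability T R)
      (M : 'I_n -> 'I_n -> {RV P >-> R}),
      random_symmetric_bernoulli M ->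
      (P [set w | (\det (mx_sample M w) = 0)%R /\
                  \rank (del_first (ltnW n_ge2) (mx_sample M w)) = (n - 2)%N]
       <= (K * n%:R `^ (- C))%R%:E)%E.
Proof.
(* An integer exponent [c > C] suffices, since [n ^- c <= n ^- C] for [n >= 1]. *)
pose c := Num.bound C.
have Cc : C < c%:R by apply: archi_boundP; apply: ltW.
have c_gt0 : (0 < c)%N by rewrite -(ltr_nat R); apply: lt_trans Cc.
have [K [K_gt0 KP]] := mean_corank_one_singular_asymptotic R c_gt0.
exists K; split => // -[//|m] n_ge2 d T P M hM.
have m_gt0 : (0 < m)%N by [].
have ord0E : Ordinal (ltnW n_ge2) = ord0 by apply: val_inj.
have mM i j : measurable_fun setT (fun w => mx_sample M w i j).
  by under eq_fun do rewrite mxE; exact: measurable_funPT.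
apply: (@le_trans _ _ (K / m.+1%:R ^+ c)%:E); last first.
  rewrite lee_fin ler_pM2l // -powR_mulrn // -powRN ler_powR ?ler1n //.
  by rewrite lerN2 ltW.
apply: le_trans (_ : (mean (fun t => (corank_one_singular R (m := m) t)%:R))%:E <= _)%E.
  apply: probability_le_mean hM _ _.
    apply: measurableI; first exact: measurable_det_eq0.
    apply: measurable_rank_eq => i j; rewrite /del_first.
    by under eq_fun do rewrite !mxE; exact: measurable_funPT.
  move=> w t [detM rankM] MtE.
  have sampleE : mx_sample M w = map_mx intr (sign_mx t).
    by apply/matrixP => i j; rewrite !mxE MtE /sgnb rmorphXn rmorphN1.
  apply/andP; split.
    by rewrite -(intr_eq0 R) -det_map_mx -sampleE detM.
  apply/eqP; move: rankM; rewrite /del_first ord0E sampleE subn2 /= => <-.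
  by congr mxrank; apply/matrixP => i j; rewrite !mxE.
by rewrite lee_fin KP.
Qed.
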